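(* Let $\mathcal{K}\hookrightarrow\mathcal{L}$ be an inclusion of finite simplicial complexes, where $\mathcal{L}$ is a $(q+1)$-dimensional orientable pseudomanifold whose dual graph is connected, and suppose the persistent up Laplacian $\Delta_{q,\mathrm{up}}^{\mathcal{K},\mathcal{L}}$ is nonzero. Let $\lambda_{\min}^+$ be its smallest nonzero eigenvalue, and let $\Delta:=\max_{1\le i\le m}A_i/V_i$. 1. If $\mathcal{L}$ is boundaryless, then $$\frac{h_{\mathrm{vol}}^2}{2\Delta}\le\lambda_{\min}^+\le 2h_{\mathrm{vol}}.$$ 2. Otherwise, $$\frac{(h_{\mathrm{vol}}^{\mathrm{Bdy}})^2}{2\Delta}\le\lambda_{\min}^+\le h_{\mathrm{vol}}^{\mathrm{Bdy}}.$$
   Context: **Persistent up Laplacian.** $C_q^{\mathcal{X}}$ denotes real $q$-chains of a finite simplicial complex $\mathcal{X}$ with the inner product making oriented $q$-simplices orthonormal; $\partial_q^{\mathcal{X}}$ is the boundary operator. For $\mathcal{K}\subseteq\mathcal{L}$: $C_{q+1}^{\mathcal{L},\mathcal{K}}=\{c\in C_{q+1}^{\mathcal{L}}:\partial_{q+1}^{\mathcal{L}}c\in C_q^{\mathcal{K}}\}$, $\partial_{q+1}^{\mathcal{L},\mathcal{K}}:C_{q+1}^{\mathcal{L},\mathcal{K}}\to C_q^{\mathcal{K}}$ is the restriction of $\partial_{q+1}^{\mathcal{L}}$, and $\Delta_{q,\mathrm{up}}^{\mathcal{K},\mathcal{L}}=\partial_{q+1}^{\mathcal{L},\mathcal{K}}(\partial_{q+1}^{\mathcal{L},\mathcal{K}})^*$.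 **Pseudomanifolds.** A $(q+1)$-dimensional complex $\mathcal{L}$ is an orientable pseudomanifold if every $q$-simplex is a face of at most two $(q+1)$-simplices and the $(q+1)$-simplices can be oriented so that they induce opposite orientations on shared $q$-faces; such orientations are fixed. $\mathcal{L}$ is boundaryless if every $q$-simplex is a face of either zero or two $(q+1)$-simplices. The dual graph of $\mathcal{L}$ has the $(q+1)$-simplices as vertices, with an edge between two $(q+1)$-simplices sharing a $q$-face. **The chains $c_i$.** With these orientations $C_{q+1}^{\mathcal{L},\mathcal{K}}$ has a basis $c_1,\dots,c_m$ (known to exist, and unique up to order) such that each $c_i$ is a $0/1$ indicator chain of a set of $(q+1)$-simplices, and the supports are pairwise disjoint. By the $q$-faces of $c_i$ we mean the $q$-simplices with nonzero coefficient in $\partial_{q+1}^{\mathcal{L}}c_i\in C_q^{\mathcal{K}}$. Put - $V_i=\langle c_i,c_i\rangle$ = number of $(q+1)$-simplices in $c_i$; - $\mathrm{sf}_{ij}$ = number of $q$-faces shared by $c_i$ and $c_j$ ($i\ne j$); - $\mathrm{free}_i$ = number of $q$-faces of $c_i$ not shared with any other $c_j$; - $A_i=\mathrm{free}_i+\sum_{j\ne i}\mathrm{sf}_{ij}$. **Cheeger constants.** For nonempty $S\subseteq\{1,\dots,m\}$: $\mathrm{Vol}(S)=\sum_{i\in S}V_i$, $\mathrm{Cut}(S)=\sum_{i\in S,\,j\notin S}\mathrm{sf}_{ij}$, $\mathrm{Bdy}(S)=\sum_{i\in S}\mathrm{free}_i$; $V_{\mathrm{tot}}=\mathrm{Vol}(\{1,\dots,m\})$.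 Define $$h_{\mathrm{vol}}=\min_{\substack{\varnothing\ne S\subseteq\{1,\dots,m\}\\ \mathrm{Vol}(S)\le V_{\mathrm{tot}}/2}}\frac{\mathrm{Cut}(S)}{\mathrm{Vol}(S)},\qquad h_{\mathrm{vol}}^{\mathrm{Bdy}}=\min_{\varnothing\ne S\subseteq\{1,\dots,m\}}\frac{\mathrm{Cut}(S)+\mathrm{Bdy}(S)}{\mathrm{Vol}(S)}.$$ *)

(* Defs.v *)
From HB Require Import structures.
From mathcomp Require Import all_boot all_order all_algebra.
From mathcomp Require Export reals.

Set Implicit Arguments.
Unset Strict Implicit.
Unset Printing Implicit Defensive.

Import Order.TTheory GRing.Theory Num.Theory.

Local Open Scope ring_scope.

(* A finite simplicial complex on vertices taken from the finite type V is the
   set of its nonempty faces; a q-simplex is a face with q + 1 vertices. *)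
Definition simplicial_complex (V : finType) (K : {set {set V}}) : Prop :=
  set0 \notin K /\
  forall s t : {set V}, s \in K -> t \subset s -> t != set0 -> t \in K.

Definition simplices (V : finType) (q : nat) (K : {set {set V}}) :
    {set {set V}} :=
  [set s in K | #|s| == q.+1].

Definition has_dimension (V : finType) (d : nat) (K : {set {set V}}) : Prop :=
  (forall s, s \in K -> (#|s| <= d.+1)%N) /\ simplices d K != set0.

(* All chains live in one ambient space; the basis vector [simplex_chain s] is
   the simplex s oriented by the enumeration order of V, and any other
   orientation of s is +/- this vector. *)
Definition chain (V : finType) (R : realType) := {ffun {set V} -> R^o}.

Definition simplex_chain (V : finType) (R : realType) (s : {set V}) :
    chain V R :=
  [ffun t => (t == s)%:R].

Definition chains (V : finType) (R : realType) (q : nat) (K : {set {set V}}) :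
    {vspace chain V R} :=
  <<[seq simplex_chain R s | s <- enum (simplices q K)]>>%VS.

Definition inner (V : finType) (R : realType) (c d : chain V R) : R :=
  \sum_s c s * d s.

Definition supp (V : finType) (R : realType) (c : chain V R) : {set {set V}} :=
  [set s | c s != 0].

(* [s : s \ v] : the sign (-1)^i, where v is the i-th vertex of s. *)
Definition incidence (V : finType) (R : realType) (s : {set V}) (v : V) : R :=
  (-1) ^+ index v (enum s).

(* One operator for all degrees; on 0-simplices it is the augmentation onto the
   empty set, but below it is only applied in degree >= 1. *)
Definition boundary_fun (V : finType) (R : realType) (c : chain V R) :
    chain V R :=
  \sum_s c s *: (\sum_(v in s) incidence R s v *: simplex_chain R (s :\ v)).

Definition boundary (V : finType) (R : realType) : 'End(chain V R) :=
  linfun (@boundary_fun V R).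

(* The library's [linfun f] is meaningful only for linear f. *)
Lemma boundaryE (V : finType) (R : realType) (c : chain V R) :
  boundary V R c = boundary_fun c.
Proof.
have lin : linear (@boundary_fun V R).
  move=> a x y; rewrite /boundary_fun scaler_sumr -big_split /=.
  by apply: eq_bigr => s _; rewrite !ffunE scalerDl scalerA.
pose L := GRing.isLinear.Build R (chain V R) (chain V R) *:%R
  (@boundary_fun V R) lin.
pose B : {linear chain V R -> chain V R} := HB.pack (@boundary_fun V R) L.
exact: (lfunE B c).
Qed.

Section Adjoint.
Context (V : finType) (R : realType).
Implicit Types (U W : {vspace chain V R}).

(* The Riesz map u |-> <., u> of a subspace U with the restricted inner
   product; it is invertible, and f^* w is the Riesz vector of <f ., w>. *)
Definition riesz U : 'Hom(subvs_of U, 'Hom(subvs_of U, R^o)) :=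
  linfun (fun u => linfun (fun v => inner (vsval v) (vsval u) : R^o)).

Definition adjoint U W (f : 'Hom(subvs_of U, subvs_of W)) :
    'Hom(subvs_of W, subvs_of U) :=
  linfun (fun w => (riesz U)^-1%VF
    (linfun (fun u => inner (vsval (f u)) (vsval w) : R^o))).

Lemma innerC (c d : chain V R) : inner c d = inner d c.
Proof. by apply: eq_bigr => s _; rewrite mulrC. Qed.

Lemma innerDZ (d : chain V R) a x y :
  inner (a *: x + y) d = a * inner x d + inner y d.
Proof.
rewrite /inner mulr_sumr -big_split /=; apply: eq_bigr => s _.
by rewrite !ffunE mulrDl -mulrA.
Qed.

Lemma inner_eq0 (c : chain V R) : inner c c = 0 -> c = 0.
Proof.
move=> /eqP; rewrite psumr_eq0 => [/allP h|s _]; last by rewrite -expr2 sqr_ge0.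
apply/ffunP => s; rewrite ffunE; apply/eqP.
by have := h s (mem_index_enum _); rewrite mulf_eq0 orbb.
Qed.

Lemma linfunE_lin (A B : vectType R) (f : A -> B) : linear f -> linfun f =1 f.
Proof.
move=> lin x; pose L := GRing.isLinear.Build R A B *:%R f lin.
pose g : {linear A -> B} := HB.pack f L.
exact: (lfunE g x).
Qed.

Lemma formE U W (f : 'Hom(subvs_of U, subvs_of W)) (w : chain V R) u :
  linfun (fun u => inner (vsval (f u)) w : R^o) u = inner (vsval (f u)) w.
Proof. by rewrite linfunE_lin // => a x y; rewrite !linearP innerDZ. Qed.

Lemma rieszE U u v : riesz U u v = inner (vsval v) (vsval u).
Proof.
have fE (w : chain V R) (x : subvs_of U) :
    linfun (fun v : subvs_of U => inner (vsval v) w : R^o) x = inner (vsval x) w.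
  by rewrite linfunE_lin // => a y z; rewrite !linearP innerDZ.
rewrite /riesz linfunE_lin ?fE // => a x y; apply/lfunP => z /=.
rewrite add_lfunE scale_lfunE !fE !(innerC (vsval z)).
by rewrite -innerDZ ?linearP.
Qed.

Lemma riesz_inj U : lker (riesz U) == 0%VS.
Proof.
apply/lker0P => x y exy; apply/eqP; rewrite -subr_eq0.
set z := x - y; have rz : riesz U z = 0 by rewrite linearB /= exy subrr.
have : riesz U z z = 0 by rewrite rz lfunE.
rewrite rieszE => /inner_eq0 h; apply/eqP/val_inj.
by apply: etrans h _; rewrite linear0.
Qed.

Lemma rieszK U (phi : 'Hom(subvs_of U, R^o)) :
  riesz U ((riesz U)^-1%VF phi) = phi.
Proof.
have surj : limg (riesz U) = fullv.
  apply/eqP; rewrite eqEdim subvf /= limg_dim_eq ?(eqP (riesz_inj U)) ?capv0 //.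
  by rewrite !dimvf /dim /= muln1.
by apply: limg_lfunVK; rewrite surj memvf.
Qed.

Lemma adjointP U W (f : 'Hom(subvs_of U, subvs_of W)) u w :
  inner (vsval (f u)) (vsval w) = inner (vsval u) (vsval (adjoint f w)).
Proof.
have -> : adjoint f w = (riesz U)^-1%VF
    (linfun (fun u => inner (vsval (f u)) (vsval w) : R^o)).
  apply: linfunE_lin => a x y; rewrite -linearP; congr (_ _).
  apply/lfunP => z; rewrite add_lfunE scale_lfunE !formE !(innerC (vsval (f z))).
  by rewrite -innerDZ ?linearP.
by rewrite -rieszE rieszK formE.
Qed.

End Adjoint.

(* C_{q+1}^{L,K} *)
Definition persistent_chains (V : finType) (R : realType) (q : nat)
    (K L : {set {set V}}) : {vspace chain V R} :=
  (chains R q.+1 L :&: boundary V R @^-1: chains R q K)%VS.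

(* [vsproj] is used here only on vectors that already lie in C_q^K. *)
Definition persistent_boundary (V : finType) (R : realType) (q : nat)
    (K L : {set {set V}}) :
    'Hom(subvs_of (persistent_chains R q K L), subvs_of (chains R q K)) :=
  linfun (fun c => vsproj (chains R q K) (boundary V R (vsval c))).

Lemma persistent_boundaryE (V : finType) (R : realType) (q : nat)
    (K L : {set {set V}}) (c : subvs_of (persistent_chains R q K L)) :
  vsval (persistent_boundary R q K L c) = boundary V R (vsval c).
Proof.
rewrite /persistent_boundary linfunE_lin; last by move=> a x y; rewrite !linearP.
rewrite vsprojK // memv_preim.
by have := subvsP c; rewrite memv_cap => /andP[].
Qed.

Definition persistent_up_laplacian (V : finType) (R : realType) (q : nat)
    (K L : {set {set V}}) : 'End(subvs_of (chains R q K)) :=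
  (persistent_boundary R q K L \o adjoint (persistent_boundary R q K L))%VF.

Definition smallest_nonzero_eigenvalue (R : realType) (E : vectType R)
    (f : 'End(E)) (lambda : R) : Prop :=
  [/\ passmx.leigenvalue f lambda, lambda != 0
    & forall mu : R, passmx.leigenvalue f mu -> mu != 0 -> lambda <= mu].

Definition cofaces (V : finType) (q : nat) (L : {set {set V}}) (f : {set V}) :
    {set {set V}} :=
  [set s in simplices q.+1 L | f \subset s].

(* o s tells whether the chosen orientation of the (q+1)-simplex s is the
   opposite (true) of the enumeration orientation; the induced orientation of
   the face s \ v then has sign (-1)^(o s) [s : s \ v]. *)
Definition coherent_orientation (V : finType) (q : nat) (L : {set {set V}})
    (o : {set V} -> bool) : Prop :=
  forall (s t : {set V}) (v w : V),
    s \in simplices q.+1 L -> t \in simplices q.+1 L -> s != t ->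
    v \in s -> w \in t -> s :\ v = t :\ w ->
    (-1) ^+ o s * (-1) ^+ index v (enum s)
      = - ((-1) ^+ o t * (-1) ^+ index w (enum t)) :> int.

Definition orientable_pseudomanifold (V : finType) (q : nat)
    (L : {set {set V}}) : Prop :=
  [/\ simplicial_complex L, has_dimension q.+1 L,
      forall f, f \in simplices q L -> (#|cofaces q L f| <= 2)%N
    & exists o, coherent_orientation q L o].

Definition boundaryless (V : finType) (q : nat) (L : {set {set V}}) : Prop :=
  forall f, f \in simplices q L ->
    #|cofaces q L f| = 0%N \/ #|cofaces q L f| = 2%N.

Definition dual_adj (V : finType) (q : nat) (L : {set {set V}}) :
    rel {set V} :=
  fun s t => [&& s \in simplices q.+1 L, t \in simplices q.+1 L, s != t
    & [exists f in simplices q L, (f \subset s) && (f \subset t)]].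

Definition dual_connected (V : finType) (q : nat) (L : {set {set V}}) : Prop :=
  forall s t, s \in simplices q.+1 L -> t \in simplices q.+1 L ->
    connect (dual_adj q L) s t.

(* The 0/1 indicator chain of S for the orientations o. *)
Definition indicator (V : finType) (R : realType) (o : {set V} -> bool)
    (S : {set {set V}}) : chain V R :=
  \sum_(s in S) (-1) ^+ o s *: simplex_chain R s.

Definition indicator_basis (V : finType) (R : realType) (q : nat)
    (K L : {set {set V}}) (o : {set V} -> bool) (m : nat)
    (c : 'I_m -> chain V R) : Prop :=
  [/\ basis_of (persistent_chains R q K L) [tuple c i | i < m],
      forall i, exists2 S : {set {set V}},
        S \subset simplices q.+1 L & c i = indicator R o S
    & forall i j, i != j -> [disjoint supp (c i) & supp (c j)]].

(* Automatically a set of q-simplices of K when c is in C_{q+1}^{L,K}. *)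
Definition qfaces (V : finType) (R : realType) (c : chain V R) :
    {set {set V}} :=
  supp (boundary V R c).

Definition vol (V : finType) (R : realType) (m : nat) (c : 'I_m -> chain V R)
    (i : 'I_m) : R :=
  inner (c i) (c i).

Definition sf (V : finType) (R : realType) (m : nat) (c : 'I_m -> chain V R)
    (i j : 'I_m) : nat :=
  #|qfaces (c i) :&: qfaces (c j)|.

Definition free_faces (V : finType) (R : realType) (m : nat)
    (c : 'I_m -> chain V R) (i : 'I_m) : nat :=
  #|qfaces (c i) :\: \bigcup_(j | j != i) qfaces (c j)|.

Definition area (V : finType) (R : realType) (m : nat) (c : 'I_m -> chain V R)
    (i : 'I_m) : nat :=
  (free_faces c i + \sum_(j | j != i) sf c i j)%N.

Definition Vol (V : finType) (R : realType) (m : nat) (c : 'I_m -> chain V R)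
    (S : {set 'I_m}) : R :=
  \sum_(i in S) vol c i.

Definition Cut (V : finType) (R : realType) (m : nat) (c : 'I_m -> chain V R)
    (S : {set 'I_m}) : nat :=
  (\sum_(i in S) \sum_(j in ~: S) sf c i j)%N.

Definition Bdy (V : finType) (R : realType) (m : nat) (c : 'I_m -> chain V R)
    (S : {set 'I_m}) : nat :=
  (\sum_(i in S) free_faces c i)%N.

(* The minimum of a nonempty list. *)
Definition minimum (R : realType) (s : seq R) : R :=
  \big[Num.min/head 0 s]_(x <- s) x.

Lemma minimum_in (R : realType) (s : seq R) : s != [::] -> minimum s \in s.
Proof.
case: s => // a s _; rewrite /minimum /=.
have h (r : seq R) : \big[Num.min/a]_(x <- r) x \in a :: r.
  elim: r => [|b r IH]; first by rewrite big_nil mem_head.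
  rewrite big_cons /Num.min; case: ifP => _; first by rewrite !inE eqxx orbT.
  by move: IH; rewrite !inE => /orP[->|->]; rewrite ?orbT.
by have := h (a :: s); rewrite !inE orbA orbb.
Qed.

Lemma minimum_le (R : realType) (s : seq R) x : x \in s -> minimum s <= x.
Proof.
rewrite /minimum; elim: s (head 0 s) => // b s IH d.
rewrite inE big_cons ge_min => /orP[/eqP->|/IH ->]; by rewrite ?lexx ?orbT.
Qed.

Definition h_vol (V : finType) (R : realType) (m : nat)
    (c : 'I_m -> chain V R) : R :=
  minimum [seq (Cut c A)%:R / Vol c A | A in
    [set A : {set 'I_m} | (A != set0) && (Vol c A <= Vol c setT / 2)]].

Definition h_vol_Bdy (V : finType) (R : realType) (m : nat)
    (c : 'I_m -> chain V R) : R :=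
  minimum [seq (Cut c A + Bdy c A)%:R / Vol c A | A in
    [set A : {set 'I_m} | A != set0]].

(* The ratios are nonnegative, so starting the maximum at 0 is harmless. *)
Definition max_ratio (V : finType) (R : realType) (m : nat)
    (c : 'I_m -> chain V R) : R :=
  \big[Num.max/0]_(i < m) ((area c i)%:R / vol c i).

(* Main.v *)
(* The eigenvalue equation on the image of the persistent boundary operator
   pulls back to chains w in C_{q+1}^{L,K}: <dw, du> = lambda <w, u> for all u.
   In the coordinates of the basis c_i, <dw, du> is the Dirichlet form of the
   weighted graph with edge weights sf_ij and killing term free_i: a q-face has
   at most two cofaces and they induce opposite signs on it, so
   <dc_i, dc_j> = - sf_ij and <dc_i, dc_i> = A_i.  The theorem becomes a Cheeger
   inequality for this graph.

   Lower bounds: apply the coarea inequality to the squares of the positive part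
   (boundaryless case) or of the absolute value (otherwise) of an eigenvector.
   Upper bounds: lambda is at most the Rayleigh quotient of any chain orthogonal
   to the cycles.  Connectedness of the dual graph makes every (q+1)-cycle
   constant in the coherent orientations; hence the cycles are spanned by
   sum_i c_i if L is boundaryless, and are zero otherwise. *)

Require Import Defs.
From mathcomp Require Import all_boot all_order all_algebra reals.
From mathcomp Require Import complex ring lra.

Set Implicit Arguments.
Unset Strict Implicit.
Unset Printing Implicit Defensive.

Import Order.TTheory GRing.Theory Num.Theory.

Local Open Scope ring_scope.

(** * Cheeger inequalities for weighted graphs *)

Section WeightedGraph.
Context (R : realFieldType) (I : finType).
Variables (w : I -> I -> R) (fr : I -> R).
Implicit Types (x y z : I -> R) (T D : {set I}).

(** The double sum runs over ordered pairs, so halving it counts each edge once; [fr] is a killing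
    term, that is, the weight of an edge to an extra vertex where functions vanish. *)
Definition dirichlet_form x y : R :=
  (\sum_i \sum_j w i j * ((x i - x j) * (y i - y j))) / 2
    + \sum_i fr i * (x i * y i).

(** The killing term carries no absolute value because the coarea inequality applies this only to
    nonnegative z. *)
Definition total_variation z : R :=
  (\sum_i \sum_j w i j * `|z i - z j|) / 2 + \sum_i fr i * z i.

Definition boundary_weight T : R :=
  \sum_(i in T) \sum_(j in ~: T) w i j + \sum_(i in T) fr i.

Hypothesis w_sym : forall i j, w i j = w j i.
Hypothesis w_ge0 : forall i j, 0 <= w i j.
Hypothesis fr_ge0 : forall i, 0 <= fr i.
Variable V : I -> R.

Lemma dirichlet_formE x y :
  dirichlet_form x y = \sum_i (fr i + \sum_j w i j) * (x i * y i)
    - \sum_i \sum_j w i j * (x i * y j).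
Proof.
set A := \sum_i \sum_j w i j * (x i * y i).
set B := \sum_i \sum_j w i j * (x i * y j).
have AE : \sum_i \sum_j w i j * (x j * y j) = A.
  rewrite exchange_big; apply: eq_bigr => i _; apply: eq_bigr => j _.
  by rewrite w_sym.
have BE : \sum_i \sum_j w i j * (x j * y i) = B.
  rewrite exchange_big; apply: eq_bigr => i _; apply: eq_bigr => j _.
  by rewrite w_sym.
have -> : \sum_i (fr i + \sum_j w i j) * (x i * y i)
    = \sum_i fr i * (x i * y i) + A.
  rewrite -big_split; apply: eq_bigr => i _ /=.
  by rewrite mulrDl mulr_suml.
have -> : dirichlet_form x y = (A + A - (B + B)) / 2 + \sum_i fr i * (x i * y i).
  congr (_ / _ + _); rewrite -{2}AE -{2}BE -!big_split -sumrB.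
  apply: eq_bigr => i _; rewrite -!big_split -sumrB; apply: eq_bigr => j _ /=.
  by ring.
by field.
Qed.

(** A crossing pair occurs in both orders, once leaving T and once entering it, and by symmetry of
    [w] the two contributions agree. *)
Lemma sum_crossing T :
  (\sum_i \sum_j w i j * ((i \in T) != (j \in T))%:R) / 2
    = \sum_(i in T) \sum_(j in ~: T) w i j :> R.
Proof.
set C := RHS.
have CE : C = \sum_i \sum_j w i j * ((i \in T) && (j \notin T))%:R.
  rewrite /C big_mkcond; apply: eq_bigr => i _; case: ifP => iT /=.
    rewrite big_mkcond; apply: eq_bigr => j _.
    by rewrite inE; case: (j \in T) => /=; rewrite ?mulr1 ?mulr0.
  by rewrite big1 // => j _; rewrite mulr0.
have CE' : C = \sum_i \sum_j w i j * ((i \notin T) && (j \in T))%:R.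
  rewrite CE exchange_big; apply: eq_bigr => i _; apply: eq_bigr => j _.
  by rewrite w_sym andbC.
suff -> : \sum_i \sum_j w i j * ((i \in T) != (j \in T))%:R = C + C by field.
rewrite {1}CE CE' -big_split; apply: eq_bigr => i _.
rewrite -big_split; apply: eq_bigr => j _ /=; rewrite -mulrDr; congr (_ * _).
by case: (i \in T); case: (j \in T); rewrite ?addr0 ?add0r.
Qed.

Lemma dirichlet_form_indicator T :
  dirichlet_form (fun i => (i \in T)%:R) (fun i => (i \in T)%:R)
    = boundary_weight T.
Proof.
rewrite /dirichlet_form /boundary_weight -sum_crossing; congr (_ / _ + _).
  apply: eq_bigr => i _; apply: eq_bigr => j _; congr (_ * _).
  by case: (i \in T); case: (j \in T); rewrite /= ?subrr ?sub0r ?subr0; ring.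
rewrite [RHS]big_mkcond; apply: eq_bigr => i _.
by case: (i \in T); rewrite /= ?mulr0 ?mulr1.
Qed.

(* Discrete coarea inequality: peel off the lowest positive level of z. *)
Lemma coarea h D z :
    (forall T, T != set0 -> T \subset D ->
      h * \sum_(i in T) V i <= boundary_weight T) ->
    (forall i, 0 <= z i) -> (forall i, i \notin D -> z i = 0) ->
  h * \sum_i V i * z i <= total_variation z.
Proof.
move=> hD; have [n] := ubnP #|[set i | z i != 0]|.
elim: n z => // n IH z; set T := [set i | _] => leTn z_ge0 zD.
have [T0|TN0] := eqVneq T set0.
  have z0 i : z i = 0.
    by apply/eqP; have := in_set0 i; rewrite -T0 inE => /negbFE.
  rewrite big1 ?mulr0 => [|i _]; last by rewrite z0 mulr0.
  rewrite /total_variation !big1 ?mul0r ?addr0 // => i _; rewrite ?z0 ?mulr0 //.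
  by rewrite big1 // => j _; rewrite !z0 subrr normr0 mulr0.
have [k0 k0T] := set0Pn _ TN0.
have zT i : i \in T -> 0 < z i by rewrite inE lt0r z_ge0 => ->.
have z0 i : i \notin T -> z i = 0 by rewrite inE negbK => /eqP.
pose k := [arg min_(k < k0 in T) z k]%O.
have [kT kmin] : k \in T /\ forall i, i \in T -> z k <= z i.
  by rewrite /k; case: arg_minP => // j jT jm; split.
pose z' i := z i - z k * (i \in T)%:R.
have z'_ge0 i : 0 <= z' i.
  rewrite /z'; case: (boolP (i \in T)) => iT /=; last by rewrite mulr0 subr0.
  by rewrite mulr1 subr_ge0 kmin.
have TD : T \subset D.
  by apply/subsetP => i; apply: contraTT => /zD zi; rewrite inE zi eqxx.
have /IH : (#|[set i | z' i != 0%R]| < n)%N.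
  rewrite -ltnS (leq_trans _ leTn) // ltnS proper_card //.
  apply/properP; split.
    apply/subsetP => i; rewrite inE; apply: contraR => iT.
    by rewrite /z' (z0 _ iT) (negPf iT) mulr0 subr0.
  by exists k => //; rewrite inE /z' kT mulr1 subrr eqxx.
move=> /(_ z'_ge0); have z'D i : i \notin D -> z' i = 0.
  move=> iD; have iT : i \notin T by apply: contra iD => /(subsetP TD).
  by rewrite /z' (z0 _ iT) (negPf iT) mulr0 subr0.
move=> /(_ z'D) IHz'; have hT := ler_wpM2l (ltW (zT _ kT)) (hD _ TN0 TD).
have zE i : z i = z' i + z k * (i \in T)%:R by rewrite /z' subrK.
have -> : h * \sum_i V i * z i
    = h * \sum_i V i * z' i + z k * (h * \sum_(i in T) V i).
  rewrite mulrCA -mulrDr; congr (_ * _); rewrite [in X in _ * X]big_mkcond.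
  rewrite mulr_sumr -big_split; apply: eq_bigr => i _ /=.
  by rewrite {1}zE; case: (i \in T); rewrite /= ?mulr1n ?mulr0n; ring.
(* Total variation is only subadditive in general. It splits exactly here because z is at least
   [z k] on T and vanishes off T, so z' and the indicator of T never vary in opposite directions. *)
suff -> : total_variation z = total_variation z' + z k * boundary_weight T.
  exact: lerD.
rewrite /total_variation /boundary_weight -sum_crossing mulrDr !mulrA addrACA.
congr (_ + _).
  rewrite -mulrDl; congr (_ / _); rewrite mulr_sumr -big_split.
  apply: eq_bigr => i _; rewrite mulr_sumr -big_split; apply: eq_bigr => j _ /=.
  rewrite mulrCA -mulrDr; congr (_ * _).
  have zk := ltW (zT _ kT).
  case: (boolP (i \in T)) => iT; case: (boolP (j \in T)) => jT /=.
  - by rewrite mulr0 addr0 /z' iT jT; congr `|_|; ring.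
  - rewrite mulr1 /z' iT (negPf jT) (z0 _ jT) mulr0 mulr1 !subr0.
    by rewrite !ger0_norm ?subr_ge0 ?kmin ?z_ge0 ?subrK.
  - rewrite mulr1 /z' jT (negPf iT) (z0 _ iT) mulr0 subr0 mulr1 !sub0r.
    by rewrite !normrN !ger0_norm ?subr_ge0 ?kmin ?z_ge0 ?subrK.
  - by rewrite mulr0 addr0 /z' (negPf iT) (negPf jT); congr `|_|; ring.
rewrite mulr_sumr [in X in _ + X]big_mkcond -big_split; apply: eq_bigr => i _ /=.
by rewrite {1}zE; case: (i \in T); rewrite /= ?mulr1n ?mulr0n; ring.
Qed.

(** Coarea for y^2 gives h N <= TV(y^2), and |y_i^2 - y_j^2| = |y_i - y_j| (y_i + y_j) splits the
    variation into a Dirichlet factor and a factor bounded by the degrees. Weighting the two by h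
    and lam replaces Cauchy-Schwarz and avoids square roots. The conclusion is free of division, so
    d = 0 needs no separate case. *)
Lemma cheeger_lower h lam d D y :
    0 <= h -> 0 < lam ->
    (forall T, T != set0 -> T \subset D ->
      h * \sum_(i in T) V i <= boundary_weight T) ->
    (forall i, 0 <= y i) -> (forall i, i \notin D -> y i = 0) ->
    (forall i, fr i + \sum_j w i j <= d * V i) ->
    0 < \sum_i V i * y i ^+ 2 ->
    dirichlet_form y y <= lam * \sum_i V i * y i ^+ 2 ->
  h ^+ 2 <= 2 * d * lam.
Proof.
move=> h0 l0 hD y0 yD wd; set N := \sum_i _ => N0 dN.
have co : h * N <= total_variation (fun i => y i ^+ 2).
  apply: coarea hD _ _ => i; first by rewrite sqr_ge0.
  by move=> /yD ->; rewrite expr0n.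
(* The second factor: (y_i + y_j)^2 <= 2 y_i^2 + 2 y_j^2 bounds b by twice the weighted degree sum
   plus one killing sum. Adding a second, nonnegative killing sum gives the bound 2 d N. *)
pose b := (\sum_i \sum_j w i j * (y i + y j) ^+ 2) / 2 + \sum_i fr i * y i ^+ 2.
have bN : b <= 2 * d * N.
  have s1 : \sum_i \sum_j w i j * (y i + y j) ^+ 2 <=
      \sum_i \sum_j w i j * (2 * y i ^+ 2) + \sum_i \sum_j w i j * (2 * y j ^+ 2).
    rewrite -big_split; apply: ler_sum => i _; rewrite -big_split.
    apply: ler_sum => j _ /=; rewrite -mulrDr ler_wpM2l //.
    by have := sqr_ge0 (y i - y j); nra.
  have s2 : \sum_i \sum_j w i j * (2 * y j ^+ 2)
      = \sum_i \sum_j w i j * (2 * y i ^+ 2).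
    rewrite exchange_big; apply: eq_bigr => i _; apply: eq_bigr => j _.
    by rewrite w_sym.
  have s3 : \sum_i \sum_j w i j * (2 * y i ^+ 2) =
      2 * \sum_i (\sum_j w i j) * y i ^+ 2.
    rewrite mulr_sumr; apply: eq_bigr => i _; rewrite mulr_suml mulr_sumr.
    by apply: eq_bigr => j _; ring.
  have s4 : \sum_i (\sum_j w i j) * y i ^+ 2 + \sum_i fr i * y i ^+ 2 <= d * N.
    rewrite mulr_sumr -big_split; apply: ler_sum => i _ /=.
    by rewrite -mulrDl mulrA addrC ler_wpM2r ?sqr_ge0.
  have s5 : 0 <= \sum_i fr i * y i ^+ 2.
    by apply: sumr_ge0 => i _; rewrite mulr_ge0 ?sqr_ge0.
  rewrite /b; rewrite s2 s3 in s1; lra.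
(* AM-GM in the form 2 (h p) (lam r) <= h^2 p^2 + lam^2 r^2, termwise *)
have amgm : 2 * h * lam * total_variation (fun i => y i ^+ 2)
    <= h ^+ 2 * dirichlet_form y y + lam ^+ 2 * b.
  rewrite /total_variation /dirichlet_form /b !mulrDr addrACA !mulrA.
  rewrite -mulrDl; apply: lerD.
    rewrite ler_pM2r ?invr_gt0 ?ltr0n // !mulr_sumr -big_split.
    apply: ler_sum => i _; rewrite !mulr_sumr -big_split; apply: ler_sum => j _ /=.
    have -> : `|y i ^+ 2 - y j ^+ 2| = `|y i - y j| * (y i + y j).
      by rewrite subr_sqr normrM [`|y i + y j|]ger0_norm ?addr_ge0.
    have -> : (y i - y j) * (y i - y j) = `|y i - y j| ^+ 2.
      by rewrite real_normK ?num_real // expr2.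
    move: (`|y i - y j|) (y i + y j) => p r; rewrite -subr_ge0.
    have -> : h ^+ 2 * (w i j * p ^+ 2) + lam ^+ 2 * (w i j * r ^+ 2)
        - 2 * h * lam * (w i j * (p * r)) = w i j * (h * p - lam * r) ^+ 2 by ring.
    by rewrite mulr_ge0 ?sqr_ge0.
  rewrite !mulr_sumr -big_split; apply: ler_sum => i _ /=; rewrite -subr_ge0.
  have -> : h ^+ 2 * (fr i * (y i * y i)) + lam ^+ 2 * (fr i * y i ^+ 2)
        - 2 * h * lam * (fr i * y i ^+ 2) = fr i * (y i * (h - lam)) ^+ 2 by ring.
  by rewrite mulr_ge0 ?sqr_ge0.
have e1 : 2 * h * lam * (h * N) <= 2 * h * lam * total_variation (fun i => y i ^+ 2).
  by rewrite ler_wpM2l // !mulr_ge0 // ltW.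
have e2 : h ^+ 2 * dirichlet_form y y <= h ^+ 2 * (lam * N).
  by rewrite ler_wpM2l ?sqr_ge0.
have e3 : lam ^+ 2 * b <= lam ^+ 2 * (2 * d * N).
  by rewrite ler_wpM2l ?sqr_ge0.
rewrite -(ler_pM2r (mulr_gt0 l0 N0)).
have := le_trans e1 (le_trans amgm (lerD e2 e3)).
have -> : 2 * h * lam * (h * N) = h ^+ 2 * (lam * N) + h ^+ 2 * (lam * N) by ring.
by rewrite lerD2l; congr (_ <= _); ring.
Qed.

(** The mixed form on the right is what the eigenvalue equation of x evaluates when tested against
    the positive part of x. The inequality holds pair by pair. *)
Lemma dirichlet_form_pos_part x :
  dirichlet_form (fun i => Num.max 0 (x i)) (fun i => Num.max 0 (x i))
    <= dirichlet_form x (fun i => Num.max 0 (x i)).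
Proof.
rewrite lerD // ?ler_pM2r ?invr_gt0 ?ltr0n //; apply: ler_sum => i _; last first.
  by rewrite ler_wpM2l //; case: (lerP 0 (x i)) => // _; rewrite !mulr0.
apply: ler_sum => j _; rewrite ler_wpM2l //.
by case: (lerP 0 (x i)); case: (lerP 0 (x j)); rewrite ?subrr ?mulr0 ?subr0 ?sub0r => *; nra.
Qed.

(** This is the reverse triangle inequality on each edge; the killing terms agree. *)
Lemma dirichlet_form_norm x :
  dirichlet_form (fun i => `|x i|) (fun i => `|x i|) <= dirichlet_form x x.
Proof.
rewrite lerD // ?ler_pM2r ?invr_gt0 ?ltr0n //; apply: ler_sum => i _; last first.
  by rewrite -!expr2 real_normK ?num_real.
apply: ler_sum => j _; rewrite ler_wpM2l // -!expr2 -[leRHS]real_normK ?num_real //.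
by rewrite -[leLHS]real_normK ?num_real // lerXn2r ?nnegrE // ler_dist_dist.
Qed.

End WeightedGraph.

(** * Rayleigh quotients of symmetric matrices *)

Section SymmetricMatrix.
Context (R : rcfType) (n : nat).
Implicit Types (G : 'M[R]_n) (u w : 'rV[R]_n).
Local Notation toC := (real_complex R).
Local Open Scope sesquilinear_scope.

Lemma eigenvalue_map_complex G (r : R) :
  eigenvalue (map_mx toC G) (toC r) = eigenvalue G r.
Proof. by rewrite !eigenvalue_root_char -map_char_poly fmorph_root. Qed.

Lemma trC_map_complex m p (A : 'M[R]_(m, p)) :
  (map_mx toC A)^t* = map_mx toC A^T.
Proof.
apply/matrixP => i j; rewrite !mxE; apply/CrealP/complex_realP.
by exists (A j i).
Qed.

(** Membership in the row space of G is tested by the columns of its cokernel matrix; by symmetry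
    the transposes of these columns lie in the left kernel of G. *)
Lemma symmetric_submx_ortho_ker G w :
  G^T = G -> (forall u, u *m G = 0 -> w *m u^T = 0) -> (w <= G)%MS.
Proof.
move=> Gsym wker; rewrite submxE; apply/eqP/rowP => j.
have /wker : (col j (cokermx G))^T *m G = 0.
  by rewrite -{2}Gsym -trmx_mul colE mulmxA mulmx_coker mul0mx trmx0.
by move=> /matrixP/(_ 0 0); rewrite trmxK colE mulmxA -colE [in LHS]mxE => ->; rewrite !mxE.
Qed.

(* Orthogonality to the kernel gives w = y G; in a unitary eigenbasis over R[i]
   the coordinates of w then vanish on the zero eigenspace. *)
Lemma symmetric_rayleigh G (lam : R) w :
    G^T = G -> (forall a, eigenvalue G a -> a != 0 -> lam <= a) ->
    (forall u, u *m G = 0 -> w *m u^T = 0) ->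
  lam * (w *m w^T) 0 0 <= (w *m G *m w^T) 0 0.
Proof.
move=> Gsym lamP /(symmetric_submx_ortho_ker Gsym)/submxP[y wE].
pose GC := map_mx toC G; pose wC := map_mx toC w.
have GCherm : GC \is hermsymmx.
  by apply/is_hermitianmxP; rewrite expr0 scale1r trC_map_complex Gsym.
pose P := spectralmx GC; pose d := spectral_diag GC.
have Pu : P \is unitarymx := spectral_unitarymx GC.
have GCE : GC = P^t* *m diag_mx d *m P.
  by rewrite -(invmx_unitary Pu); exact/orthomx_spectralP/hermitian_normalmx.
pose a := wC *m P^t*; pose b := map_mx toC y *m P^t*.
have aE k : a 0 k = b 0 k * d 0 k.
  have -> : a = b *m diag_mx d.
    by rewrite /a /wC wE map_mxM -/GC GCE !mulmxA mulmxtVK.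
  by rewrite mul_mx_diag mxE.
have ww : (wC *m wC^t*) 0 0 = \sum_k `|a 0 k| ^+ 2.
  have -> : wC *m wC^t* = a *m a^t*.
    by rewrite /a trmx_mul map_mxM trmxCK mulmxA mulmxKtV.
  by rewrite mxE; apply: eq_bigr => k _; rewrite !mxE normCK.
have wGw : (wC *m GC *m wC^t*) 0 0 = \sum_k d 0 k * `|a 0 k| ^+ 2.
  have -> : wC *m GC *m wC^t* = a *m diag_mx d *m a^t*.
    by rewrite /a trmx_mul map_mxM trmxCK GCE !mulmxA.
  rewrite mxE; apply: eq_bigr => k _.
  by rewrite mul_mx_diag !mxE normCK mulrCA mulrA.
have toCE m p (A : 'M[R]_(m, p)) i j : (map_mx toC A) i j = toC (A i j).
  by rewrite mxE.
rewrite -lecR -!toCE rmorphM /= -toCE !map_mxM /= -trC_map_complex -/wC -/GC.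
rewrite ww wGw mulr_sumr; apply: ler_sum => k _.
have [dk0|dkN0] := eqVneq (d 0 k) 0.
  by rewrite aE dk0 mulr0 normr0 expr0n /= !mulr0.
rewrite ler_wpM2r ?exprn_ge0 ?normr_ge0 //.
have /mxOverP/(_ 0 k)/complex_realP[r drE] := hermitian_spectral_diag_real GCherm.
rewrite -/d in drE; rewrite drE lecR lamP //; last first.
  by apply: contraNneq dkN0 => r0; rewrite drE r0.
(* The eigenvector is a row of the unitary matrix P, nonzero because it has norm 1. *)
rewrite -eigenvalue_map_complex -/GC; apply/eigenvalueP; exists (row k P).
  rewrite -row_mul GCE !mulmxA (unitarymxP _) // mul1mx row_mul row_diag_mx.
  by rewrite -scalemxAl -rowE drE.
apply/eqP => Pk0; have /row_unitarymxP/(_ k k) := Pu.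
by rewrite Pk0 eqxx linear0l => /eqP; rewrite eq_sym oner_eq0.
Qed.

End SymmetricMatrix.

(** * Chains and the persistent up Laplacian *)

Section Chains.
Context (V : finType) (R : realType).
Implicit Types (c d w u : chain V R) (K L S : {set {set V}}) (s t f : {set V}).

Lemma inner_suml (I : finType) (x : I -> R) (a : I -> chain V R) d :
  inner (\sum_i x i *: a i) d = \sum_i x i * inner (a i) d.
Proof.
elim/big_rec2: _ => [|i y z _ <-]; last by rewrite innerDZ.
by rewrite /inner big1 // => s _; rewrite ffunE mul0r.
Qed.

Lemma inner_sumr (I : finType) (x : I -> R) (a : I -> chain V R) d :
  inner d (\sum_i x i *: a i) = \sum_i x i * inner d (a i).
Proof. by rewrite innerC inner_suml; apply: eq_bigr => i _; rewrite innerC. Qed.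

Lemma innerZl k c d : inner (k *: c) d = k * inner c d.
Proof. by rewrite /inner mulr_sumr; apply: eq_bigr => s _; rewrite ffunE mulrA. Qed.

Lemma innerZr k c d : inner d (k *: c) = k * inner d c.
Proof. by rewrite innerC innerZl innerC. Qed.

Lemma inner_ge0 c : 0 <= inner c c.
Proof. by apply: sumr_ge0 => s _; rewrite -expr2 sqr_ge0. Qed.

Lemma inner_gt0 c : c != 0 -> 0 < inner c c.
Proof. by rewrite lt0r inner_ge0 andbT; apply: contra_neq => /inner_eq0. Qed.

Lemma inner0l d : inner 0 d = 0.
Proof. by rewrite -(scale0r d) innerZl mul0r. Qed.

Lemma simplex_chainE c : c = \sum_s c s *: simplex_chain R s.
Proof.
apply/ffunP => t; rewrite sum_ffunE (bigD1 t) //= !ffunE eqxx [X in _ + X]big1.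
  by rewrite addr0 /GRing.scale /= mulr1.
by move=> s /negPf st; rewrite !ffunE eq_sym st scaler0.
Qed.

Lemma chainsP q K c :
  reflect (forall s, s \notin simplices q K -> c s = 0) (c \in chains R q K).
Proof.
apply: (iffP idP) => [/coord_span -> s sK|c0].
  rewrite sum_ffunE big1 // => i _; rewrite ffunE.
  pose X := [seq simplex_chain R s | s <- enum (simplices q K)].
  have /mapP[t] : X`_i \in X by rewrite mem_nth // size_map -cardE.
  rewrite mem_enum => tK Xi; rewrite -/X Xi ffunE; case: eqVneq => [st|_]; last exact: scaler0.
  by rewrite st tK in sK.
rewrite [c]simplex_chainE; apply: memv_suml => s _.
have [sK|/c0 ->] := boolP (s \in simplices q K); last by rewrite scale0r mem0v.
by rewrite memvZ // memv_span // map_f // mem_enum.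
Qed.

Lemma boundary_coeff w f :
  boundary V R w f
    = \sum_s w s * \sum_(v in s | s :\ v == f) incidence R s v.
Proof.
rewrite boundaryE /boundary_fun sum_ffunE; apply: eq_bigr => s _.
rewrite ffunE; congr (_ * _); rewrite sum_ffunE [RHS]big_mkcondr.
apply: eq_bigr => v _; rewrite !ffunE eq_sym; case: eqVneq => _.
  by rewrite /GRing.scale /= mulr1.
by rewrite scaler0.
Qed.

Lemma indicatorE (o : {set V} -> bool) S s :
  indicator R o S s = (s \in S)%:R * (-1) ^+ o s.
Proof.
rewrite /indicator sum_ffunE; case: (boolP (s \in S)) => sS.
  rewrite (bigD1 s) //= big1 => [|t /andP[_ /negPf ts]].
    by rewrite !ffunE eqxx addr0 mul1r /GRing.scale /= mulr1.
  by rewrite !ffunE eq_sym ts scaler0.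
rewrite mul0r big1 // => t tS; rewrite !ffunE; case: eqVneq => [st|_].
  by rewrite st tS in sS.
exact: scaler0.
Qed.

Lemma supp_indicator (o : {set V} -> bool) S : supp (indicator R o S) = S.
Proof.
apply/setP => s; rewrite inE indicatorE.
by case: (s \in S); rewrite ?mul0r ?eqxx // mul1r signr_eq0.
Qed.

End Chains.

(** * Eigenvalues and Rayleigh quotients of the persistent up Laplacian *)

Section PersistentLaplacian.
Context (V : finType) (R : realType) (q : nat) (K L : {set {set V}}).
Local Notation P := (persistent_chains R q K L).
Local Notation Lap := (persistent_up_laplacian R q K L).
Local Notation D := (persistent_boundary R q K L).
Local Notation bd := (boundary V R).

Lemma leigenvalueP (E : vectType R) (g : 'End(E)) a :
  reflect (exists2 v, v != 0 & g v = a *: v) (passmx.leigenvalue g a).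
Proof.
have memE v : (v \in passmx.leigenspace g a) = (g v == a *: v).
  by rewrite memv_ker add_lfunE opp_lfunE scale_lfunE id_lfunE subr_eq0.
apply: (iffP idP) => [gN0|[v vN0 gv]].
  exists (vpick (passmx.leigenspace g a)); first by rewrite vpick0.
  by apply/eqP; rewrite -memE memv_pick.
apply: contraNneq vN0 => g0; rewrite -memv0.
by have /eqP := gv; rewrite -memE g0.
Qed.

(** This is the weak form of D^* D w = a w, stated on ambient chains so that neither the adjoint nor
    the subspace types appear. *)
Definition persistent_eigenchain (a : R) (w : chain V R) : Prop :=
  [/\ w \in P, w != 0 & forall u, u \in P -> inner (bd w) (bd u) = a * inner w u].

(** D D^* and D^* D have the same nonzero eigenvalues: D^* and D carry eigenvectors of one to the
    other, and a <> 0 keeps the images nonzero. *)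
Lemma laplacian_eigenvalueP a : a != 0 ->
  passmx.leigenvalue Lap a <-> exists w, persistent_eigenchain a w.
Proof.
move=> aN0; split=> [/leigenvalueP[v vN0]|[w [wP wN0 wE]]].
  rewrite comp_lfunE => /= gv; set g := adjoint D v in gv.
  exists (vsval g); split; first exact: subvsP.
    apply: contraNneq vN0 => g0; have {}g0 : g = 0 by apply/val_inj.
    by move/eqP: gv; rewrite g0 linear0 eq_sym scaler_eq0 (negPf aN0).
  move=> u uP; have uE : vsval (vsproj P u) = u by rewrite vsprojK.
  rewrite -persistent_boundaryE gv linearZ /= innerZl; congr (_ * _).
  by rewrite -{1}uE -persistent_boundaryE innerC adjointP uE innerC.
pose g := vsproj P w; have gE : vsval g = w by rewrite vsprojK.
(* The difference of the two sides is orthogonal to every persistent chain, in particular to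
   itself. *)
have adjE : adjoint D (D g) = a *: g.
  apply/eqP; rewrite -subr_eq0; set z := _ - _.
  suff /inner_eq0 z0 : inner (vsval z) (vsval z) = 0.
    by apply/eqP/val_inj; apply: etrans z0 _; rewrite linear0.
  have zE : vsval z = - a *: w + vsval (adjoint D (D g)).
    by rewrite /z linearB linearZ /= gE addrC scaleNr scalerN.
  rewrite {1}zE innerDZ [inner (vsval (adjoint _ _)) _]innerC -adjointP.
  rewrite !persistent_boundaryE gE [inner (bd (vsval z)) _]innerC.
  by rewrite wE ?subvsP // mulNr addNr.
apply/leigenvalueP; exists (D g).
  apply: contraNneq wN0 => Dg0; move: adjE; rewrite Dg0 linear0 => /esym/eqP.
  by rewrite scaler_eq0 (negPf aN0) /= -gE => /eqP ->; rewrite linear0.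
by rewrite comp_lfunE adjE linearZ.
Qed.

Lemma basis_comb m (c : 'I_m -> chain V R) (U : {vspace chain V R}) w :
  basis_of U [tuple c i | i < m] -> w \in U ->
  exists x : 'I_m -> R, w = \sum_i x i *: c i.
Proof.
move=> cU /(coord_basis cU) ->; exists (fun i => coord [tuple c i | i < m] i w).
by apply: eq_bigr => i _; rewrite -tnth_nth tnth_mktuple.
Qed.

Lemma basis_memv m (c : 'I_m -> chain V R) (U : {vspace chain V R}) i :
  basis_of U [tuple c i | i < m] -> c i \in U.
Proof.
by move=> cU; apply: (basis_mem cU); apply/tnthP; exists i; rewrite tnth_mktuple.
Qed.

(** After normalising c to an orthonormal basis, the form <bd ., bd .> has a symmetric Gram matrix.
    Its eigenvectors with nonzero eigenvalue are coordinates of eigenchains, so the matrix bound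
    applies. *)
Lemma persistent_rayleigh m (c : 'I_m -> chain V R) (lam : R) w :
    basis_of P [tuple c i | i < m] ->
    (forall i j, i != j -> inner (c i) (c j) = 0) ->
    (forall i, c i != 0) ->
    smallest_nonzero_eigenvalue Lap lam ->
    w \in P -> (forall u, u \in P -> bd u = 0 -> inner w u = 0) ->
  lam * inner w w <= inner (bd w) (bd w).
Proof.
move=> cP cort cN0 [_ _ lamP] wP wker.
pose k i := (Num.sqrt (inner (c i) (c i)))^-1.
have k_gt0 i : 0 < k i by rewrite invr_gt0 sqrtr_gt0 inner_gt0.
pose e i := k i *: c i.
have ee i j : inner (e i) (e j) = (i == j)%:R.
  rewrite innerZl innerZr; case: eqVneq => [->|/cort ->]; last by rewrite !mulr0.
  rewrite /k mulrA -invfM -expr2 sqr_sqrtr ?inner_ge0 // mulVf //.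
  by rewrite gt_eqF // inner_gt0.
pose E (v : 'rV[R]_m) : chain V R := \sum_i v 0 i *: e i.
have Eip u v : inner (E u) (E v) = (u *m v^T) 0 0.
  rewrite inner_suml mxE; apply: eq_bigr => i _; congr (_ * _).
  rewrite inner_sumr (bigD1 i) //= big1 => [|j /negPf ji].
    by rewrite ee eqxx mulr1 addr0 mxE.
  by rewrite ee eq_sym ji mulr0.
have bdE v : bd (E v) = \sum_i v 0 i *: bd (e i).
  by rewrite linear_sum; apply: eq_bigr => i _; rewrite linearZ.
pose G := \matrix_(i, j) inner (bd (e i)) (bd (e j)).
have Gsym : G^T = G by apply/matrixP => i j; rewrite !mxE innerC.
have EG u v : inner (bd (E u)) (bd (E v)) = (u *m G *m v^T) 0 0.
  rewrite !bdE inner_sumr mxE; apply: eq_bigr => j _.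
  rewrite inner_suml !mxE mulrC; congr (_ * _); apply: eq_bigr => i _.
  by rewrite mxE.
have EP v : E v \in P.
  by apply: memv_suml => i _; rewrite !memvZ // (basis_memv _ cP).
have Esurj z : z \in P -> exists v, z = E v.
  move=> /(basis_comb cP)[x ->]; exists (\row_i (x i / k i)).
  by apply: eq_bigr => i _; rewrite mxE scalerA divfK // gt_eqF.
have [v vE] := Esurj _ wP; rewrite vE in wker *; rewrite Eip EG.
apply: symmetric_rayleigh => // [a /eigenvalueP[u uG uN0] aN0|u uG].
  apply: lamP => //; apply/laplacian_eigenvalueP => //; exists (E u); split=> //.
    apply: contraNneq uN0 => Eu0; apply/eqP/rowP => i; rewrite mxE.
    have := Eip u (delta_mx 0 i); rewrite Eu0 inner0l trmx_delta -colE mxE.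
    by move=> <-.
  move=> z /Esurj[y ->]; rewrite EG Eip uG -scalemxAl mxE.
  done.
(* If u G = 0, the boundary of [E u] has norm 0, so [E u] is a cycle and w is orthogonal to it. *)
apply/matrixP => i j; rewrite !ord1 -Eip wker ?mxE //.
by apply: inner_eq0; rewrite EG uG mul0mx mxE.
Qed.

End PersistentLaplacian.

(** * Coherent orientations *)

Section Orientation.
Context (V : finType) (R : realType) (q : nat) (L : {set {set V}}).
Context (o : {set V} -> bool).
Hypothesis hL : orientable_pseudomanifold q L.
Hypothesis ho : coherent_orientation q L o.
Implicit Types (w : chain V R) (S : {set {set V}}) (s t f : {set V}).
Local Notation bd := (boundary V R).
Local Notation X := (simplices q.+1 L).

(** The sum has at most one term; writing it as a sum extends the sign by 0 to every f that is not a
    facet of s. *)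
Definition induced_sign s f : R :=
  (-1) ^+ o s * \sum_(v in s | s :\ v == f) incidence R s v.
Local Notation eta := induced_sign.

Lemma induced_signE s v : v \in s ->
  eta s (s :\ v) = (-1) ^+ o s * (-1) ^+ index v (enum s).
Proof.
move=> vs; rewrite /induced_sign (big_pred1 v) // => u /=.
apply/andP/eqP => [[us /eqP uv]|->]; last by rewrite vs eqxx.
by apply/eqP; have := setD11 u s; rewrite uv !inE us andbT => /negbFE.
Qed.

Lemma induced_sign_neq0P s f : eta s f != 0 ->
  exists2 v, v \in s & f = s :\ v.
Proof.
move=> sf; case: (pickP (fun v => (v \in s) && (s :\ v == f))) => [v /andP[vs /eqP]|h].
  by exists v.
by move: sf; rewrite /induced_sign big_pred0 ?mulr0 ?eqxx.
Qed.

Lemma induced_sign_sqr s f : eta s f != 0 -> eta s f ^+ 2 = 1.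
Proof.
move=> /induced_sign_neq0P[v vs ->]; rewrite induced_signE // exprMn.
by rewrite !sqrr_sign mulr1.
Qed.

Lemma induced_sign_opp s t f : s \in X -> t \in X -> s != t ->
  eta s f != 0 -> eta t f != 0 -> eta s f = - eta t f.
Proof.
move=> sX tX st /induced_sign_neq0P[v vs fs] /induced_sign_neq0P[u ut ft].
rewrite {1}fs ft !induced_signE //.
have := ho sX tX st vs ut (etrans (esym fs) ft).
by move=> /(congr1 (fun z : int => z%:~R : R)); rewrite rmorphN !rmorphM !rmorphXn !rmorphN1.
Qed.

Lemma induced_sign_face s f : s \in X -> eta s f != 0 ->
  f \in simplices q L /\ s \in cofaces q L f.
Proof.
rewrite inE => /andP[sL /eqP sq] /induced_sign_neq0P[v vs ->].
have [[_ hcl] _ _ _] := hL.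
have c : #|s :\ v| = q.+1 by have := cardsD1 v s; rewrite vs sq => -[].
split; last by rewrite !inE sL sq eqxx subsetDl.
by rewrite inE c eqxx andbT (hcl s) ?subsetDl // -card_gt0 c.
Qed.

Lemma induced_sign_coface s f : f \in simplices q L -> s \in cofaces q L f ->
  eta s f != 0.
Proof.
rewrite !inE => /andP[_ /eqP fq] /andP[/andP[_ /eqP sq] fs].
have /eqP/cards1P[v vE] : #|s :\: f| = 1%N.
  by rewrite cardsD (setIidPr fs) sq fq subSn // subnn.
have vs : v \in s by have := set11 v; rewrite -vE inE => /andP[].
have -> : f = s :\ v by rewrite -vE setDDr setDv set0U (setIidPr fs).
by rewrite induced_signE // mulf_neq0 ?signr_eq0.
Qed.

(** The distinct simplices s and t already exhaust the at most two cofaces of f. *)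
Lemma induced_sign_le2 s t u f : s \in X -> t \in X -> u \in X ->
  eta s f != 0 -> eta t f != 0 -> eta u f != 0 -> s != t -> (u == s) || (u == t).
Proof.
move=> sX tX uX /(induced_sign_face sX)[fL sf] /(induced_sign_face tX)[_ tf].
move=> /(induced_sign_face uX)[_ uf] st; have [_ _ /(_ f fL) le2 _] := hL.
have sub : [set s; t] \subset cofaces q L f by rewrite subUset !sub1set sf.
have /eqP eq2 : [set s; t] == cofaces q L f by rewrite eqEcard sub cards2 st.
by rewrite -eq2 !inE in uf.
Qed.

(** The coordinate of w at s in the basis of coherently oriented simplices. *)
Definition oriented_coeff w s : R := (-1) ^+ o s * w s.

Lemma boundary_oriented w f : w \in chains R q.+1 L ->
  bd w f = \sum_(s in X) oriented_coeff w s * eta s f.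
Proof.
move=> /chainsP w0; rewrite boundary_coeff [RHS]big_mkcond.
apply: eq_bigr => s _; case: ifPn => [_|/w0 ->]; last by rewrite mul0r.
by rewrite /oriented_coeff /induced_sign mulrACA -expr2 sqrr_sign mul1r.
Qed.

Lemma indicator_chains S : S \subset X -> indicator R o S \in chains R q.+1 L.
Proof.
move=> SX; apply/chainsP => s sX; rewrite indicatorE.
by rewrite (contraNF (subsetP SX s) sX) mul0r.
Qed.

Lemma oriented_coeff_indicator S s :
  oriented_coeff (indicator R o S) s = (s \in S)%:R.
Proof.
by rewrite /oriented_coeff indicatorE mulrCA -expr2 sqrr_sign mulr1.
Qed.

Lemma boundary_indicator S f : S \subset X ->
  bd (indicator R o S) f = \sum_(s in S) eta s f.
Proof.
move=> SX; rewrite boundary_oriented ?indicator_chains // [RHS]big_mkcond.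
rewrite [LHS]big_mkcond; apply: eq_bigr => s _.
rewrite oriented_coeff_indicator; case: ifPn => [_|sX].
  by case: ifP; rewrite ?mul1r ?mul0r.
by rewrite (contraNF (subsetP SX s) sX).
Qed.

(* Two simplices of S on the same face would cancel, so a face that survives in
   the boundary has exactly one coface in S. *)
Lemma boundary_indicator_face S f : S \subset X -> bd (indicator R o S) f != 0 ->
  exists s, [/\ s \in S, eta s f != 0 & bd (indicator R o S) f = eta s f].
Proof.
move=> SX; rewrite boundary_indicator // => bN0.
have [s /andP[sS sf]|h] := pickP (fun s => (s \in S) && (eta s f != 0)); last first.
  by move: bN0; rewrite big1 ?eqxx // => s sS; have := h s; rewrite sS => /negbFE/eqP.
exists s; split=> //; rewrite (bigD1 s) //= big1 ?addr0 // => t /andP[tS ts].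
apply: contraNeq bN0 => tf.
have sX := subsetP SX _ sS; have tX := subsetP SX _ tS.
rewrite (bigD1 s) //= (bigD1 t) /=; last by rewrite tS ts.
rewrite (induced_sign_opp tX sX ts tf sf) big1 ?addr0 ?subrr //.
move=> u /andP[/andP[uS us] ut]; apply: contraTeq us => uf.
have := induced_sign_le2 sX tX (subsetP SX _ uS) sf tf uf.
by rewrite eq_sym ts (negPf ut) orbF => /(_ isT) ->.
Qed.

(** On a face shared by two adjacent simplices only these two contribute to the boundary, with
    opposite signs, so their coefficients agree; the equality propagates along a path in the dual
    graph. *)
Lemma cycle_constant w s t : dual_connected q L -> w \in chains R q.+1 L ->
  bd w = 0 -> s \in X -> t \in X -> oriented_coeff w s = oriented_coeff w t.
Proof.
move=> hconn wX w0 sX tX.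
have step (s1 t1 : {set V}) : dual_adj q L s1 t1 ->
    oriented_coeff w s1 = oriented_coeff w t1.
  case/and4P => s1X t1X st /exists_inP[f fL /andP[fs ft]].
  have s1f : eta s1 f != 0 by rewrite induced_sign_coface // inE s1X.
  have t1f : eta t1 f != 0 by rewrite induced_sign_coface // inE t1X.
  have := boundary_oriented f wX; rewrite w0 ffunE (bigD1 s1) //= (bigD1 t1) /=; last first.
    by rewrite t1X eq_sym.
  rewrite big1 => [|u /andP[/andP[uX us] ut]]; last first.
    apply/eqP; rewrite mulf_eq0; apply/orP; right; apply: contraNT us => uf.
    have := induced_sign_le2 s1X t1X uX s1f t1f uf st.
    by rewrite (negPf ut) orbF => ->.
  rewrite addr0 (induced_sign_opp s1X t1X st s1f t1f) mulrN addrC -mulrBl.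
  by move=> /esym/eqP; rewrite mulf_eq0 (negPf t1f) orbF subr_eq0 => /eqP ->.
have /connectP[p + ->] := hconn _ _ sX tX.
elim: p s {sX} => //= t1 p IH s1 /andP[/step -> /IH //].
Qed.

(** Some q-simplex has exactly one coface. There the boundary coefficient of w is, up to sign, the
    coefficient of that coface, which therefore vanishes, and constancy does the rest. *)
Lemma cycle_eq0 w : dual_connected q L -> ~ boundaryless q L ->
  w \in chains R q.+1 L -> bd w = 0 -> w = 0.
Proof.
move=> hconn nb wX w0.
have [f /and3P[fL f0 f2]|h] := pickP (fun f => [&& f \in simplices q L,
    #|cofaces q L f| != 0%N & #|cofaces q L f| != 2]); last first.
  case: nb => f fL; have /= := h f; rewrite fL /=.
  by case: eqP; [left|case: eqP; [right|]].
have [_ _ /(_ f fL) le2 _] := hL.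
have /cards1P[s0 cE] : #|cofaces q L f| == 1%N.
  by move: f0 f2 le2; case: #|_| => [|[|[|]]].
have s0c : s0 \in cofaces q L f by rewrite cE set11.
have s0X : s0 \in X by move: s0c; rewrite inE => /andP[].
have sf := induced_sign_coface fL s0c.
have := boundary_oriented f wX; rewrite w0 ffunE (bigD1 s0) //= big1 => [|t /andP[tX ts]].
  rewrite addr0 => /esym/eqP; rewrite mulf_eq0 (negPf sf) orbF => /eqP c0.
  apply/ffunP => s; rewrite ffunE; have [sX|] := boolP (s \in X); last exact/chainsP.
  have := cycle_constant hconn wX w0 sX s0X; rewrite c0 => /eqP.
  by rewrite mulf_eq0 signr_eq0 => /eqP.
apply/eqP; rewrite mulf_eq0; apply/orP; right; apply: contraNT ts => tf.
by have [_] := induced_sign_face tX tf; rewrite cE inE => ->.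
Qed.

(** A face surviving in the boundary would have a coface, hence exactly two, and their induced signs
    cancel. *)
Lemma boundary_fundamental : boundaryless q L -> bd (indicator R o X) = 0.
Proof.
move=> hb; apply/ffunP => f; rewrite [RHS]ffunE; apply/eqP; apply: contraT => bN0.
have [s [sX sf bE]] := boundary_indicator_face (subxx X) bN0.
have [fL sc] := induced_sign_face sX sf.
have /eqP c2 : #|cofaces q L f| == 2.
  by case: (hb f fL) => [/eqP|->//]; rewrite cards_eq0 => /eqP c0; rewrite c0 inE in sc.
have /card_gt0P[t] : (0 < #|cofaces q L f :\ s|)%N.
  by have := cardsD1 s (cofaces q L f); rewrite sc c2; case: #|_|.
rewrite !inE => /andP[ts tc].
have tX : t \in X by rewrite inE; case/andP: tc.
have tf : eta t f != 0 by rewrite induced_sign_coface // inE tX; case/andP: tc.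
move: bE bN0; rewrite boundary_indicator // (bigD1 s) //= (bigD1 t) /= ?tX //.
rewrite (induced_sign_opp tX sX ts tf sf) big1 ?addr0 ?subrr ?eqxx //.
move=> u /andP[/andP[uX us] ut]; apply/eqP; apply: contraNT us => uf.
have := induced_sign_le2 sX tX uX sf tf uf.
by rewrite eq_sym ts (negPf ut) orbF => /(_ isT) ->.
Qed.

End Orientation.

(** * The Dirichlet form of the indicator basis *)

Section IndicatorBasis.
Context (V : finType) (R : realType) (q : nat) (K L : {set {set V}}).
Context (o : {set V} -> bool) (m : nat) (c : 'I_m -> chain V R).
Hypothesis hL : orientable_pseudomanifold q L.
Hypothesis ho : coherent_orientation q L o.
Hypothesis hc : indicator_basis q K L o c.
Local Notation bd := (boundary V R).
Local Notation X := (simplices q.+1 L).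
Local Notation P := (persistent_chains R q K L).
Local Notation eta := (induced_sign R o).

Definition comb (x : 'I_m -> R) : chain V R := \sum_i x i *: c i.
(** The diagonal is reset because [sf c i i] counts all q-faces of [c i]. *)
Definition shared_weight (i j : 'I_m) : R := if i == j then 0 else (sf c i j)%:R.
Definition free_weight (i : 'I_m) : R := (free_faces c i)%:R.
Local Notation form := (dirichlet_form shared_weight free_weight).

Lemma sfC i j : sf c i j = sf c j i.
Proof. by rewrite /sf setIC. Qed.

Lemma shared_weight_sym i j : shared_weight i j = shared_weight j i.
Proof. by rewrite /shared_weight eq_sym sfC. Qed.

Lemma shared_weight_ge0 i j : 0 <= shared_weight i j.
Proof. by rewrite /shared_weight; case: eqP. Qed.

Lemma area_weight i : (area c i)%:R = free_weight i + \sum_j shared_weight i j.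
Proof.
rewrite /area natrD natr_sum; congr (_ + _); rewrite big_mkcond.
by apply: eq_bigr => j _; rewrite /shared_weight eq_sym; case: eqP.
Qed.

Lemma boundary_weightE A :
  boundary_weight shared_weight free_weight A = (Cut c A + Bdy c A)%:R.
Proof.
rewrite natrD !natr_sum; congr (_ + _); apply: eq_bigr => i iA.
rewrite natr_sum; apply: eq_bigr => j; rewrite inE /shared_weight => jA.
by case: eqP jA => // <-; rewrite iA.
Qed.

Let cP : basis_of P [tuple c i | i < m]. Proof. by case: hc. Qed.

Let suppX i : supp (c i) \subset X.
Proof. by have [_ /(_ i)[S SX ->] _] := hc; rewrite supp_indicator. Qed.

Let cE i : c i = indicator R o (supp (c i)).
Proof. by have [_ /(_ i)[S SX ->] _] := hc; rewrite supp_indicator. Qed.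

Let supp_neq i j s t : i != j -> s \in supp (c i) -> t \in supp (c j) -> s != t.
Proof.
have [_ _ cdis] := hc => ij si; apply: contraTneq => <-.
by rewrite (disjointFr (cdis _ _ ij) si).
Qed.

Lemma indicator_basis_neq0 i : c i != 0.
Proof.
have /basis_free/free_not0 := cP; apply.
by apply/tnthP; exists i; rewrite tnth_mktuple.
Qed.

Lemma vol_gt0 i : 0 < vol c i.
Proof. exact/inner_gt0/indicator_basis_neq0. Qed.

Lemma indicator_basis_ortho i j : i != j -> inner (c i) (c j) = 0.
Proof.
move=> ij; apply: big1 => s _; apply/eqP; apply: contraT.
rewrite mulf_eq0 negb_or => /andP[si sj].
have := @supp_neq i j s s ij; rewrite !inE => /(_ si sj).
by rewrite eqxx.
Qed.

Lemma comb_persistent x : comb x \in P.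
Proof. by apply: memv_suml => i _; rewrite memvZ // (basis_memv _ cP). Qed.

Lemma inner_comb x y : inner (comb x) (comb y) = \sum_i vol c i * (x i * y i).
Proof.
rewrite inner_suml; apply: eq_bigr => i _.
rewrite inner_sumr (bigD1 i) //= big1 => [|j ji]; first by rewrite addr0 /vol; ring.
by rewrite indicator_basis_ortho ?mulr0 // eq_sym.
Qed.

Lemma boundary_basis_face i f : f \in qfaces (c i) ->
  exists s, [/\ s \in supp (c i), eta s f != 0 & bd (c i) f = eta s f].
Proof.
by rewrite inE {1}cE => /(boundary_indicator_face hL ho (suppX i)); rewrite -cE.
Qed.

Lemma boundary_basis_sqr i f : bd (c i) f * bd (c i) f = (f \in qfaces (c i))%:R.
Proof.
have [/boundary_basis_face[s [_ sf ->]]|] := boolP (f \in _).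
  by rewrite -expr2 induced_sign_sqr.
by rewrite inE negbK => /eqP ->; rewrite mulr0.
Qed.

Lemma boundary_basis_mul i j f : i != j ->
  bd (c i) f * bd (c j) f = - (f \in qfaces (c i) :&: qfaces (c j))%:R.
Proof.
move=> ij; rewrite in_setI.
have [/boundary_basis_face[s [si sf ->]]|] := boolP (f \in qfaces (c i)); last first.
  by rewrite inE negbK => /eqP ->; rewrite mul0r oppr0.
have [/boundary_basis_face[t [tj tf ->]]|] := boolP (f \in qfaces (c j)); last first.
  by rewrite inE negbK => /eqP ->; rewrite mulr0 oppr0.
have sX := subsetP (suppX _) _ si; have tX := subsetP (suppX _) _ tj.
rewrite (induced_sign_opp ho sX tX (supp_neq ij si tj)) //.
by rewrite mulNr -expr2 induced_sign_sqr.
Qed.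

(** Each chain having f as a q-face contains a coface of f. The supports are disjoint, so three
    chains would give three cofaces. *)
Lemma qfaces_le2 i j k f : j != i -> k != i -> j != k ->
  f \in qfaces (c i) -> f \in qfaces (c j) -> f \notin qfaces (c k).
Proof.
move=> ji ki jk /boundary_basis_face[s [si sf _]] /boundary_basis_face[t [tj tf _]].
apply/negP => /boundary_basis_face[u [uk uf _]].
have h l s' : s' \in supp (c l) -> s' \in X := subsetP (suppX l) s'.
have st : s != t by apply: supp_neq si tj; rewrite eq_sym.
have := induced_sign_le2 hL (h _ _ si) (h _ _ tj) (h _ _ uk) sf tf uf st.
rewrite (negPf (supp_neq ki uk si)) (negPf (supp_neq _ uk tj)) //.
by rewrite eq_sym.
Qed.

(** No face is shared by three chains, so the faces shared with different j form disjoint sets and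
    the sum of the [sf] counts each non-free face once. *)
Lemma card_qfaces i : #|qfaces (c i)| = area c i.
Proof.
pose F j := if j == i then set0 else qfaces (c i) :&: qfaces (c j).
have FD j k : j != k -> [disjoint F j & F k].
  move=> jk; rewrite /F; case: (eqVneq j i) => [_|ji].
    by rewrite -setI_eq0 set0I.
  case: (eqVneq k i) => [_|ki]; first by rewrite -setI_eq0 setI0.
  rewrite -setI_eq0; apply/set0Pn => -[f]; rewrite !in_setI.
  case/andP => /andP[fi fj] /andP[_ fk].
  by have := qfaces_le2 ji ki jk fi fj; rewrite fk.
have FU : qfaces (c i) :&: \bigcup_(j | j != i) qfaces (c j) = \bigcup_j F j.
  rewrite big_distrr big_mkcond; apply: eq_bigr => j _.
  by rewrite /F; case: eqP.
rewrite -(cardsID (\bigcup_(j | j != i) qfaces (c j))) addnC; congr (_ + _)%N.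
rewrite FU -sum1_card partition_disjoint_bigcup // [RHS]big_mkcond.
apply: eq_bigr => j _; rewrite sum1_card /F; case: eqVneq => // _.
exact: cards0.
Qed.

Lemma boundary_gram i j : inner (bd (c i)) (bd (c j))
  = if i == j then (area c i)%:R else - shared_weight i j.
Proof.
have sumC (A : {set {set V}}) : \sum_f (f \in A)%:R = #|A|%:R :> R.
  by rewrite -natr_sum -sum1_card [in RHS]big_mkcond.
rewrite /inner; case: eqVneq => [<-|ij].
  by under eq_bigr do rewrite boundary_basis_sqr; rewrite sumC card_qfaces.
under eq_bigr do rewrite boundary_basis_mul //.
by rewrite sumrN sumC /shared_weight (negPf ij).
Qed.

Lemma boundary_comb x : bd (comb x) = \sum_i x i *: bd (c i).
Proof. by rewrite linear_sum; apply: eq_bigr => i _; rewrite linearZ. Qed.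

Lemma inner_boundary_comb x y : inner (bd (comb x)) (bd (comb y)) = form x y.
Proof.
rewrite dirichlet_formE; last exact: shared_weight_sym.
rewrite !boundary_comb inner_suml -sumrB; apply: eq_bigr => i _.
rewrite inner_sumr (bigD1 i) //= boundary_gram eqxx -area_weight mulrDr.
congr (_ + _); first by ring.
rewrite [in RHS](bigD1 i) //= {1}/shared_weight eqxx mul0r add0r -sumrN mulr_sumr.
apply: eq_bigr => j ji; rewrite boundary_gram eq_sym (negPf ji); ring.
Qed.

(** The fundamental chain is a cycle, hence persistent, and expands in the basis. Evaluation at a
    simplex of the support of [c i], where all other basis chains vanish, shows that the i-th
    coefficient is 1. *)
Lemma comb1 : boundaryless q L -> comb (fun=> 1) = indicator R o X.
Proof.
move=> hb; have : indicator R o X \in P.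
  by rewrite memv_cap indicator_chains //= -memv_preim boundary_fundamental ?mem0v.
move=> /(basis_comb cP)[x xE]; rewrite xE; apply: eq_bigr => i _; congr (_ *: _).
have [s sN0] : exists s, c i s != 0.
  apply/existsP; apply: contraNT (indicator_basis_neq0 i); rewrite negb_exists.
  by move=> /forallP h; apply/eqP/ffunP => s; rewrite ffunE; apply/eqP/negPn/h.
have si : s \in supp (c i) by rewrite inE.
have := congr1 (fun d : chain V R => d s) xE.
rewrite /= indicatorE (subsetP (suppX i) _ si) mul1r.
rewrite sum_ffunE (bigD1 i) //= big1 => [|j ji].
  rewrite addr0 ffunE cE indicatorE si mul1r.
  have sgN0 : (-1) ^+ o s != 0 :> R by rewrite signr_eq0.
  by move=> h; apply: (mulIf sgN0); rewrite mul1r.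
have : s \notin supp (c j).
  by apply/negP => sj; have := supp_neq ji sj si; rewrite eqxx.
by rewrite inE negbK ffunE => /eqP ->; rewrite scaler0.
Qed.

(** * Cheeger bounds for the smallest nonzero eigenvalue *)

Section Eigenvalue.
Context (lam : R).
Hypothesis hconn : dual_connected q L.
Hypothesis hlam : smallest_nonzero_eigenvalue (persistent_up_laplacian R q K L) lam.

Lemma eigen_coords : exists x : 'I_m -> R, [/\ exists i, x i != 0,
  0 < \sum_i vol c i * (x i * x i) &
  forall y, form x y = lam * \sum_i vol c i * (x i * y i)].
Proof.
have [lamE lamN0 _] := hlam.
have [w [wP wN0 wE]] := (laplacian_eigenvalueP q K L lamN0).1 lamE.
have [x xE] := basis_comb cP wP; rewrite -/(comb x) in xE; exists x; split.
- apply/existsP; apply: contraNT wN0; rewrite negb_exists => /forallP x0.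
  by rewrite xE /comb big1 // => i _; rewrite (eqP (negPn (x0 i))) scale0r.
- by rewrite -inner_comb -xE inner_gt0.
- by move=> y; rewrite -inner_boundary_comb -inner_comb -xE wE // comb_persistent.
Qed.

Lemma lam_gt0 : 0 < lam.
Proof.
have [x [_ N0 xE]] := eigen_coords; have [_ lamN0 _] := hlam.
rewrite lt0r lamN0 -(pmulr_lge0 _ N0) -xE -inner_boundary_comb.
exact: inner_ge0.
Qed.

Lemma max_ratio_ge0 : 0 <= max_ratio c.
Proof. exact: bigmax_ge_id. Qed.

Lemma area_le i : free_weight i + \sum_j shared_weight i j <= max_ratio c * vol c i.
Proof. by rewrite -area_weight -ler_pdivrMr ?vol_gt0 // le_bigmax. Qed.

Lemma sqr_le_div_max_ratio h : h ^+ 2 <= 2 * max_ratio c * lam ->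
  h ^+ 2 / (2 * max_ratio c) <= lam.
Proof.
move=> hle; have [d0|] := eqVneq (max_ratio c) 0.
  (* Since the inverse of 0 is 0, the left side is 0 here. *)
  by rewrite d0 mulr0 invr0 mulr0 ltW // lam_gt0.
move=> dN0; rewrite ler_pdivrMr; first by rewrite mulrC.
by rewrite mulr_gt0 // lt0r dN0 max_ratio_ge0.
Qed.

Lemma Vol_gt0 A : A != set0 -> 0 < Vol c A.
Proof.
case/set0Pn => i iA; rewrite /Vol (bigD1 i) //= ltr_pwDl ?vol_gt0 //.
by apply: sumr_ge0 => j _; rewrite ltW ?vol_gt0.
Qed.

Lemma ratio_ge0 (k : nat) A : 0 <= k%:R / Vol c A.
Proof. by rewrite divr_ge0 // sumr_ge0 // => i _; rewrite ltW ?vol_gt0. Qed.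

Lemma minimum_ge0 (s : seq R) : (forall x, x \in s -> 0 <= x) -> 0 <= minimum s.
Proof.
have [->|/minimum_in h] := eqVneq s [::]; first by rewrite /minimum big_nil.
exact.
Qed.

Lemma Vol_setC A : Vol c setT = Vol c A + Vol c (~: A).
Proof.
rewrite /Vol (bigID (mem A)) /=; congr (_ + _); apply: eq_bigl => i.
  by rewrite inE.
by rewrite !inE.
Qed.

Lemma form_indicator (A : {set 'I_m}) :
  form (fun i => (i \in A)%:R) (fun i => (i \in A)%:R) = (Cut c A + Bdy c A)%:R.
Proof. by rewrite dirichlet_form_indicator ?boundary_weightE //; exact: shared_weight_sym. Qed.

Lemma inner_indicator (A : {set 'I_m}) :
  \sum_i vol c i * ((i \in A)%:R * (i \in A)%:R) = Vol c A.
Proof.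
rewrite /Vol [RHS]big_mkcond; apply: eq_bigr => i _.
by case: (i \in A); rewrite ?mulr1 ?mulr0.
Qed.

(** There are no nonzero cycles, so the indicator of a minimising set is itself an admissible test
    chain; no mean is subtracted and no factor 2 is lost. *)
Lemma cheeger_with_boundary : ~ boundaryless q L ->
  h_vol_Bdy c ^+ 2 / (2 * max_ratio c) <= lam <= h_vol_Bdy c.
Proof.
move=> nb; have [x [[i0 xi0] N0 xE]] := eigen_coords; apply/andP; split.
  apply: sqr_le_div_max_ratio.
  have sq y : \sum_i vol c i * (`|y i| ^+ 2) = \sum_i vol c i * (y i * y i) :> R.
    by apply: eq_bigr => i _; rewrite real_normK ?num_real // expr2.
  apply: (@cheeger_lower _ _ shared_weight free_weight _ _ _ (vol c) _ _ _ setT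
    (fun i => `|x i|)); rewrite ?sq ?lam_gt0 //.
  - exact: shared_weight_sym.
  - exact: shared_weight_ge0.
  - by apply: minimum_ge0 => y /imageP[A _ ->]; exact: ratio_ge0.
  - move=> T TN0 _; rewrite boundary_weightE -ler_pdivlMr; last exact: Vol_gt0.
    by apply: minimum_le; apply/imageP; exists T; rewrite ?inE.
  - by move=> i; rewrite inE.
  - exact: area_le.
  - rewrite -xE; apply: dirichlet_form_norm => //; exact: shared_weight_ge0.
(* The minimum is attained because the family is nonempty: a nonzero coordinate of the eigenvector
   supplies an index for a singleton. *)
have /minimum_in/imageP[A] : [seq (Cut c A + Bdy c A)%:R / Vol c A | A in
    [set A : {set 'I_m} | A != set0]] != [::].
  rewrite -size_eq0 size_image -lt0n; apply/card_gt0P; exists [set i0].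
  by rewrite inE -card_gt0 cards1.
rewrite inE -/(h_vol_Bdy c) => AN0 ->.
rewrite ler_pdivlMr ?Vol_gt0 // -form_indicator -inner_indicator.
rewrite -inner_comb -inner_boundary_comb.
apply: (persistent_rayleigh cP _ _ hlam).
- exact: indicator_basis_ortho.
- exact: indicator_basis_neq0.
- exact: comb_persistent.
move=> u; rewrite memv_cap => /andP[uX _] /(cycle_eq0 hL ho hconn nb uX) ->.
by rewrite innerC inner0l.
Qed.

(** * The boundaryless case *)

Section Boundaryless.
Hypothesis hb : boundaryless q L.

Lemma boundary_comb1 : bd (comb (fun=> 1)) = 0.
Proof. by rewrite comb1 // boundary_fundamental. Qed.

(** On the constant 1 the form reduces to the sum of the nonnegative free weights, and it is also
    the squared norm of the boundary of a cycle. *)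
Lemma free_weight_eq0 i : free_weight i = 0.
Proof.
have : form (fun=> 1) (fun=> 1) = 0.
  by rewrite -inner_boundary_comb boundary_comb1 inner0l.
rewrite /dirichlet_form big1 => [|j _]; last first.
  by rewrite big1 // => k _; rewrite subrr !mulr0.
rewrite mul0r add0r => /eqP; rewrite psumr_eq0 => [/allP/(_ i (mem_index_enum _))|j _].
  by rewrite !mulr1 => /eqP.
by rewrite !mulr1.
Qed.

Lemma Bdy_eq0 A : (Bdy c A)%:R = 0 :> R.
Proof. by rewrite natr_sum big1 // => i _; exact: free_weight_eq0. Qed.

Lemma cycle_comb1 u : u \in P -> bd u = 0 -> exists a, u = a *: comb (fun=> 1).
Proof.
rewrite comb1 // memv_cap => /andP[uX _] u0.
have [_ [_ /set0Pn[s0 s0X]] _ _] := hL.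
exists (oriented_coeff o u s0); apply/ffunP => s; rewrite ffunE indicatorE.
have [sX|sX] := boolP (s \in X); last first.
  by rewrite mul0r scaler0; move/chainsP: uX; apply.
rewrite (cycle_constant hL ho hconn uX u0 s0X sX) mul1r /oriented_coeff.
by rewrite /GRing.scale /= mulrAC -expr2 sqrr_sign mul1r.
Qed.

(** Testing the eigenvalue equation against the cycle with all coordinates 1 gives 0 on the left,
    and lam is nonzero. *)
Lemma eigen_coords_sum0 x :
  (forall y, form x y = lam * \sum_i vol c i * (x i * y i)) ->
  \sum_i vol c i * x i = 0.
Proof.
move=> /(_ (fun=> 1)); rewrite -inner_boundary_comb boundary_comb1 innerC inner0l.
move=> /esym/eqP; rewrite mulf_eq0 gt_eqF ?lam_gt0 //= => /eqP h.
by rewrite -[RHS]h; apply: eq_bigr => i _; rewrite mulr1.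
Qed.

Lemma sum0_pos x : (exists i, x i != 0) -> \sum_i vol c i * x i = 0 ->
  exists i, 0 < x i.
Proof.
move=> [i0 xi0] x0; apply/existsP; apply: contraNT xi0.
rewrite negb_exists => /forallP xle; apply/eqP.
have : \sum_i vol c i * (- x i) == 0.
  by under eq_bigr do rewrite mulrN; rewrite sumrN x0 oppr0.
rewrite psumr_eq0 => [/allP/(_ i0 (mem_index_enum _))|i _].
  by rewrite mulf_eq0 gt_eqF ?vol_gt0 //= oppr_eq0 => /eqP.
by rewrite mulr_ge0 ?oppr_ge0 ?(ltW (vol_gt0 _)) // leNgt xle.
Qed.

(** Every nonempty subset of the positivity set has at most half the total volume, so it competes in
    [h_vol]. This is why the positive part is used instead of the absolute value. *)
Lemma h_vol_lower x : (exists i, 0 < x i) ->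
  (forall y, form x y = lam * \sum_i vol c i * (x i * y i)) ->
  Vol c [set i | 0 < x i] <= Vol c setT / 2 ->
  h_vol c ^+ 2 / (2 * max_ratio c) <= lam.
Proof.
move=> [i0 xi0] xE small; apply: sqr_le_div_max_ratio.
pose y i := Num.max 0 (x i).
have yE : \sum_i vol c i * y i ^+ 2 = \sum_i vol c i * (x i * y i).
  apply: eq_bigr => i _; rewrite /y; case: (lerP 0 (x i)) => _; last by rewrite mulr0 expr0n mulr0.
  by rewrite expr2.
apply: (@cheeger_lower _ _ shared_weight free_weight _ _ _ (vol c) _ _ _
  [set i | 0 < x i] y); rewrite ?lam_gt0 //.
- exact: shared_weight_sym.
- exact: shared_weight_ge0.
- by apply: minimum_ge0 => z /imageP[A _ ->]; exact: ratio_ge0.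
- move=> T TN0 TD; rewrite boundary_weightE natrD Bdy_eq0 addr0.
  rewrite -ler_pdivlMr; last exact: Vol_gt0.
  apply: minimum_le; apply/imageP; exists T; rewrite // inE TN0 (le_trans _ small) //.
  rewrite /Vol [leRHS](big_setID T) /= (setIidPr TD) lerDl.
  by apply: sumr_ge0 => i _; rewrite ltW ?vol_gt0.
- by move=> i; rewrite /y le_max lexx.
- by move=> i; rewrite inE -leNgt /y => xi; apply/max_l.
- exact: area_le.
- rewrite (bigD1 i0) //= ltr_pwDl //; last first.
    by apply: sumr_ge0 => i _; rewrite mulr_ge0 ?sqr_ge0 // ltW ?vol_gt0.
  by rewrite mulr_gt0 ?vol_gt0 // exprn_gt0 // /y lt_max xi0 orbT.
rewrite yE -xE; apply: dirichlet_form_pos_part => //; exact: shared_weight_ge0.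
Qed.

(* Test the Rayleigh quotient on the indicator of A minus its mean. *)
Lemma h_vol_upper A : A != set0 -> Vol c A <= Vol c setT / 2 ->
  lam * (Vol c A / 2) <= (Cut c A)%:R.
Proof.
move=> AN0 small; have VA := Vol_gt0 AN0.
have VT : 0 < Vol c setT by lra.
pose r := Vol c A / Vol c setT.
pose z i := (i \in A)%:R - r.
have rV : r * Vol c setT = Vol c A by rewrite /r divfK // gt_eqF.
have sumA : \sum_i vol c i * (i \in A)%:R = Vol c A.
  by rewrite -inner_indicator; apply: eq_bigr => i _; case: (i \in A); rewrite ?mulr1 ?mulr0.
have sumT : \sum_i vol c i = Vol c setT by apply: eq_bigl => i; rewrite inE.
have zz : \sum_i vol c i * (z i * z i) = Vol c A - r * Vol c A.
  have -> : \sum_i vol c i * (z i * z i) = \sum_i vol c i * ((i \in A)%:R * (i \in A)%:R)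
      - 2 * r * (\sum_i vol c i * (i \in A)%:R) + r ^+ 2 * \sum_i vol c i.
    rewrite !mulr_sumr -sumrB -big_split; apply: eq_bigr => i _ /=; rewrite /z.
    by ring.
  by rewrite inner_indicator sumA sumT -rV; ring.
(* Without killing, subtracting a constant does not change the form. *)
have formz : form z z = (Cut c A)%:R.
  rewrite -[RHS]addr0 -[X in _ + X](Bdy_eq0 A) -natrD -form_indicator.
  rewrite /dirichlet_form; congr (_ / _ + _); last first.
    by apply: eq_bigr => i _; rewrite free_weight_eq0 !mul0r.
  apply: eq_bigr => i _; apply: eq_bigr => j _; congr (_ * _).
  by rewrite /z; ring.
rewrite -formz; apply: (@le_trans _ _ (lam * \sum_i vol c i * (z i * z i))).
  rewrite ler_wpM2l ?(ltW lam_gt0) // zz.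
  (* The squared norm of z is (1 - r) Vol(A) >= Vol(A) / 2, which is the source of the factor 2. *)
  have : r <= 1 / 2 by rewrite /r ler_pdivrMr //; lra.
  by nra.
rewrite -inner_comb -inner_boundary_comb.
apply: (persistent_rayleigh cP _ _ hlam).
- exact: indicator_basis_ortho.
- exact: indicator_basis_neq0.
- exact: comb_persistent.
move=> u uP /(cycle_comb1 uP)[a ->]; rewrite innerZr inner_comb.
suff -> : \sum_i vol c i * (z i * 1) = 0 by rewrite mulr0.
transitivity (\sum_i vol c i * (i \in A)%:R - r * \sum_i vol c i).
  by rewrite mulr_sumr -sumrB; apply: eq_bigr => i _; rewrite /z; ring.
by rewrite sumA sumT rV subrr.
Qed.

Lemma cheeger_boundaryless :
  h_vol c ^+ 2 / (2 * max_ratio c) <= lam <= 2 * h_vol c.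
Proof.
have [x [xN0 N0 xE]] := eigen_coords.
(* If the positivity set of x exceeds half the volume, pass to -x, whose positivity set lies in the
   complement; the weighted sum being 0 ensures that either sign has a positive coordinate. *)
have {xN0 xE N0} [y [ypos yE ysmall]] : exists y, [/\ exists i, 0 < y i,
    forall z, form y z = lam * \sum_i vol c i * (y i * z i) &
    Vol c [set i | 0 < y i] <= Vol c setT / 2].
  have x0 := eigen_coords_sum0 xE.
  have [small|big] := lerP (Vol c [set i | 0 < x i]) (Vol c setT / 2).
    by exists x; split=> //; exact: sum0_pos.
  exists (fun i => - x i); split.
  - apply: sum0_pos; first by have [i xi] := xN0; exists i; rewrite oppr_eq0.
    by under eq_bigr do rewrite mulrN; rewrite sumrN x0 oppr0.
  - move=> z; transitivity (- form x z).
      rewrite /dirichlet_form opprD -mulNr -!sumrN; congr (_ / _ + _).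
        apply: eq_bigr => i _; rewrite -sumrN; apply: eq_bigr => j _; ring.
      by apply: eq_bigr => i _; ring.
    by rewrite xE -mulrN -sumrN; congr (_ * _); apply: eq_bigr => i _; ring.
  have := Vol_setC [set i | 0 < x i].
  suff : Vol c [set i | 0 < - x i] <= Vol c (~: [set i | 0 < x i]) by lra.
  rewrite /Vol [leRHS](big_setID [set i | 0 < - x i]) /= (setIidPr _) ?lerDl.
    by apply: sumr_ge0 => i _; rewrite ltW ?vol_gt0.
  by apply/subsetP => i; rewrite !inE oppr_gt0 -leNgt => /ltW.
rewrite (h_vol_lower ypos yE ysmall) /=.
have /minimum_in/imageP[A] : [seq (Cut c A)%:R / Vol c A | A in
    [set A : {set 'I_m} | (A != set0) && (Vol c A <= Vol c setT / 2)]] != [::].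
  rewrite -size_eq0 size_image -lt0n; apply/card_gt0P; exists [set i | 0 < y i].
  by rewrite inE ysmall andbT; apply/set0Pn; have [i yi] := ypos; exists i; rewrite inE.
rewrite inE -/(h_vol c) => /andP[AN0 small] ->.
rewrite mulrA ler_pdivlMr ?Vol_gt0 //; have := h_vol_upper AN0 small; lra.
Qed.

End Boundaryless.
End Eigenvalue.
End IndicatorBasis.

Theorem mainTheorem3 (R : realType) (V : finType) (q : nat)
    (K L : {set {set V}})
    (hK : simplicial_complex K) (hKL : K \subset L)
    (hL : orientable_pseudomanifold q L)
    (hconn : dual_connected q L)
    (o : {set V} -> bool) (ho : coherent_orientation q L o)
    (m : nat) (c : 'I_m -> chain V R) (hc : indicator_basis q K L o c)
    (hnz : persistent_up_laplacian R q K L != 0)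
    (lambda : R)
    (hlambda : smallest_nonzero_eigenvalue (persistent_up_laplacian R q K L)
                 lambda) :
  (boundaryless q L ->
     h_vol c ^+ 2 / (2 * max_ratio c) <= lambda <= 2 * h_vol c) /\
  (~ boundaryless q L ->
     h_vol_Bdy c ^+ 2 / (2 * max_ratio c) <= lambda <= h_vol_Bdy c).
Proof.
split=> hb; first exact: cheeger_boundaryless hL ho hc _ hconn hlambda hb.
exact: cheeger_with_boundary hL ho hc _ hconn hlambda hb.
Qed.
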